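(* Let $n\ge2$ and let $\Gamma$ be a torsion-free finite-index subgroup of $SL_n(\mathbb{Z})$ or $GL_n(\mathbb{Z})$. Let $\xi=\sum n(\mathbf{u})\mathbf{u}\in S_1$ be a $1$-sharbly chain that is a cycle mod $\Gamma$ (i.e. its boundary vanishes in the coinvariant complex $(S_* )_\Gamma$). Construct $\xi'$ as follows. (A) For each $\mathbf{u}\in\operatorname{supp}\xi$ and each modular symbol $\mathbf{v}\in\operatorname{supp}\partial\mathbf{u}$ with $\|\mathbf{v}\|>1$, choose a candidate $w(\mathbf{v})\in\operatorname{Cand}\mathbf{v}$, the choices being $\Gamma$-equivariant: whenever $\mathbf{v}=\gamma\cdot\mathbf{v}'$ with $\gamma\in\Gamma$ for two such modular symbols (possibly coming from different elements of $\operatorname{supp}\xi$), then $w(\mathbf{v})=\gamma\cdot w(\mathbf{v}')$. (B) For each $\mathbf{u}\in\operatorname{supp}\xi$, using the permutation relation, write $\mathbf{u}=[v_1,\dots,v_{n+1}]$ so that, with $j$ the number of submodular symbols of $\partial\mathbf{u}$ of norm $>1$, the submodular symbols $\mathbf{v}^i=[v_1,\dots,\widehat{v_i},\dots,v_{n+1}]$ for $1\le i\le j$ are exactly those with $\|\mathbf{v}^i\|>1$; let $n'(\mathbf{u})$ be the resulting coefficient of this ordered $\mathbf{u}$ in $\xi$, and put $w_i=w(\mathbf{v}^i)$ for $1\le i\le j$. (C) Let $P$ be the convex hull in $\mathbb{R}^{n+1}$ of $\{e_1,\dots,e_{n+1}\}\cup\{-e_k:1\le k\le j\}$, choose a subdivision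 of $P$ into simplices without new vertices, and orient $P$ so that the induced orientation on its facet spanned by $e_1,\dots,e_{n+1}$ is opposite to that given by the ordering $e_1,\dots,e_{n+1}$. Label $e_k\leftrightarrow v_k$ ($1\le k\le n+1$) and $-e_k\leftrightarrow w_k$ ($1\le k\le j$). Each simplex of the subdivision, with its vertex labels listed in an order compatible with the orientation induced from $P$, gives a $2$-sharbly; let $\eta(\mathbf{u})\in S_2$ be the sum of these. (D) Set $\eta=\sum_{\mathbf{u}\in\operatorname{supp}\xi}n'(\mathbf{u})\eta(\mathbf{u})$ and $\xi'=\xi+\partial\eta$. For each $\mathbf{u}$ as in (B) define $\partial\eta_{\mathrm{old}}(\mathbf{u})=-[v_1,\dots,v_{n+1}]$, $\partial\eta_{\mathrm{side}}(\mathbf{u})=\sum_{k=1}^{j}[v_1,\dots,\widehat{v_k},\dots,v_{n+1},w_k]$, and $\partial\eta_{\mathrm{new}}(\mathbf{u})=\partial\eta(\mathbf{u})-\partial\eta_{\mathrm{old}}(\mathbf{u})-\partial\eta_{\mathrm{side}}(\mathbf{u})$. Then $\xi'$ is homologous to $\xi$ in $(S_* )_\Gamma$, and in $(S_1)_\Gamma$ one has $\xi'=\sum_{\mathbf{u}\in\operatorname{supp}\xi}n'(\mathbf{u})\,\partial\eta_{\mathrm{new}}(\mathbf{u})$; in particular no modular symbol $\mathbf{v}\in\operatorname{supp}\partial\mathbf{u}$ with $\|\mathbf{v}\|>1$ ($\mathbf{u}\in\operatorname{supp}\xi$) appears as a submodular symbol of $\xi'$ in this sense.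
   Context: A vector of $\mathbb{Z}^n$ is primitive if the gcd of its coordinates is $1$. The sharbly complex: for $k\ge0$, $S_k$ is the abelian group of formal $\mathbb{Z}$-linear combinations of symbols $[v_1,\dots,v_{n+k}]$ with $v_i\in\mathbb{Z}^n$ primitive, modulo the relations (a) $[v_1,\dots,v_{n+k}]=\operatorname{sign}(\tau)[v_{\tau(1)},\dots,v_{\tau(n+k)}]$ for any permutation $\tau$; (b) $[\pm v_1,v_2,\dots,v_{n+k}]=[v_1,\dots,v_{n+k}]$; (c) $[v_1,\dots,v_{n+k}]=0$ if the matrix $(v_1,\dots,v_{n+k})$ has rank $<n$. The boundary is $\partial[v_1,\dots,v_{n+k}]=\sum_{i=1}^{n+k}(-1)^i[v_1,\dots,\widehat{v_i},\dots,v_{n+k}]$. Elements $[v_1,\dots,v_{n+k}]$ are $k$-sharblies; $0$-sharblies are modular symbols. $\Gamma$ acts on the left by $\gamma\cdot[v_1,\dots]=[\gamma v_1,\dots]$, commuting with $\partial$; $(S_* )_\Gamma$ denotes the complex of coinvariants (quotient of $S_k$ by $\gamma\cdot\mathbf{u}-\mathbf{u}$). For a chain $\xi=\sum n(\mathbf{u})\mathbf{u}$, $\operatorname{supp}\xi=\{\mathbf{u}:n(\mathbf{u})\neq0\}$. For a modular symbol $\mathbf{v}=[v_1,\dots,v_n]$, $\|\mathbf{v}\|=|\det(v_1,\dots,v_n)|$, and $\operatorname{Cand}\mathbf{v}=\{w\in\mathbb{Z}^n: w\ne0,\ w=\sum q_iv_i,\ q_i\in\mathbb{Q},\ 0\le|q_i|<1\}$.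 The submodular symbols of $\xi'$ are the $n$-element subsymbols $[u_{i_1},\dots,u_{i_n}]$ of the $1$-sharblies in its support.
   Formalization: The side part carries signs (-1)^(n+1-k), without which the identity fails; candidates are primitive and equivariance is up to order and signs; the last claim covers only faces with all vertices e_i, since a face with some -e_k may coincide with an old symbol. *)

(* Defs.v *)
From HB Require Import structures.
From mathcomp.multinomials Require Export freeg.
From mathcomp Require Import all_boot all_order all_algebra.
From mathcomp Require Import perm reals.

Set Implicit Arguments.
Unset Strict Implicit.
Unset Printing Implicit Defensive.
Import Order.TTheory GRing.Theory Num.Theory.
Local Open Scope ring_scope.

(* Symbols over an alphabet A and their formal Z-linear combinations.  Both the
   sharblies (A = primitive vectors) and the oriented simplices of a subdivided
   polytope (A = its vertices) are of this kind. *)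

Definition sym (A : choiceType) (m : nat) : Type := {ffun 'I_m -> A}.
Definition chain (A : choiceType) (m : nat) := {freeg (sym A m)}.

Section Symbols.
Variable A : choiceType.

Definition reord m (x : sym A m) (t : 'S_m) : sym A m := [ffun i => x (t i)].

Definition face m (k : 'I_m.+1) (x : sym A m.+1) : sym A m :=
  [ffun i => x (lift k i)].

(* [x_1, .., x_m, a] *)
Definition append m (x : sym A m) (a : A) : sym A m.+1 :=
  [ffun i => if unlift ord_max i is Some l then x l else a].

(* Positions start at 0 here and at 1 on paper, hence the exponent k.+1. *)
Definition bdry m (c : chain A m.+1) : chain A m :=
  fglift (fun x : sym A _ => \sum_(k < m.+1) (-1 : int) ^+ k.+1 *: << face k x >>) c.

Definition alt_rel m (c : chain A m) : Prop :=
  exists (x : sym A m) (t : 'S_m), c = << x >> - (-1 : int) ^+ t *: << reord x t >>.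

Definition push (B : choiceType) (f : A -> B) m (c : chain A m) : chain B m :=
  fglift (fun x : sym A _ => << ([ffun i => f (x i)] : sym B m) >>) c.

(* For x = [x_1, .., x_n+1] and y_1, .., y_n+1, the parts
   "old" = - [x_1, .., x_n+1] and
   "side" = \sum_(k <= j) (-1)^(n+1-k) [x_1, .. omit x_k .., x_n+1, y_k]
   of the boundary of eta.  The sign moves y_k into the place of x_k, so that
   side = \sum_(k <= j) [x_1, .., y_k, .., x_n+1]: it is the orientation that
   the facet {e_i, i <> k} U {- e_k} gets from P when {e_1, .., e_n+1} gets
   the coefficient -1. *)
Definition old_part n (x : sym A n.+1) : chain A n.+1 := - << x >>.

Definition side_part n (j : nat) (x : sym A n.+1) (y : 'I_n.+1 -> A) :
    chain A n.+1 :=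
  \sum_(k < n.+1 | (k < j)%N)
     (-1 : int) ^+ (n - k) *: << append (face k x) (y k) >>.

End Symbols.

(* The subgroup generated by G; an equality in the quotient of V by it is a
   membership of the difference. *)
Inductive zspan (V : zmodType) (G : V -> Prop) : V -> Prop :=
| zspan0 : zspan G 0
| zspan_gen x : G x -> zspan G x
| zspanB x y : zspan G x -> zspan G y -> zspan G (x - y).

Definition alt_eq (A : choiceType) m (c d : chain A m) : Prop :=
  zspan (@alt_rel A m) (c - d).

(* The sharbly complex.  S_k is the quotient of chain (pvec n) (n + k) by the
   subgroup generated by sharbly_rel; the indices 0, 1, 2 are the lengths
   n, n.+1, n.+2. *)

Definition primitive n (v : 'cV[int]_n) : bool :=
  \big[gcdn/0%N]_(i < n) `|v i ord0|%N == 1%N.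

Definition pvec n : Type := {v : 'cV[int]_n | primitive v}.

Definition symmx n m (x : sym (pvec n) m) : 'M[int]_(n, m) :=
  \matrix_(i, l) val (x l) i ord0.

Definition sign_rel n m (c : chain (pvec n) m) : Prop :=
  exists x y : sym (pvec n) m,
    (forall i : 'I_m, val (y i) = val (x i) \/
                      (i = 0%N :> nat /\ val (y i) = - val (x i))) /\
    c = << y >> - << x >>.

Definition rank_rel n m (c : chain (pvec n) m) : Prop :=
  exists x : sym (pvec n) m,
    (\rank (map_mx (intr : int -> rat) (symmx x)) < n)%N /\ c = << x >>.

Definition sharbly_rel n m (c : chain (pvec n) m) : Prop :=
  [\/ alt_rel c, sign_rel c | rank_rel c].

Definition coinv_rel n (Gamma : 'M[int]_n -> Prop) m
    (c : chain (pvec n) m) : Prop :=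
  exists g (x y : sym (pvec n) m), [/\ Gamma g,
    (forall i, val (y i) = g *m val (x i)) &
    c = << y >> - << x >>].

(* Equality in the coinvariants of S under Gamma. *)
Definition coinv_eq n (Gamma : 'M[int]_n -> Prop) m
    (c d : chain (pvec n) m) : Prop :=
  zspan (fun z => sharbly_rel z \/ coinv_rel Gamma z) (c - d).

Definition homologous n (Gamma : 'M[int]_n -> Prop) m
    (c d : chain (pvec n) m) : Prop :=
  exists z : chain (pvec n) m.+1, coinv_eq Gamma (c - d) (bdry z).

Section Groups.
Variable n : nat.
Implicit Types G H : 'M[int]_n -> Prop.

Definition GLZ : 'M[int]_n -> Prop := fun g => g \in unitmx.
Definition SLZ : 'M[int]_n -> Prop := fun g => \det g = 1.

Definition subgroup_of G H : Prop :=
  [/\ forall g, H g -> G g, H 1%:M,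
      forall g h, H g -> H h -> H (g *m h) &
      forall g, H g -> H (invmx g)].

Definition finite_index G H : Prop :=
  exists r : seq 'M[int]_n,
    forall g, G g -> exists2 a, a \in r & exists2 h, H h & g = a *m h.

Definition torsion_free H : Prop :=
  forall g k, H g -> (0 < k)%N -> g ^+ k = 1 -> g = 1.

End Groups.

Section ModularSymbols.
Variable n : nat.
Implicit Types (x y v : sym (pvec n) n) (u : sym (pvec n) n.+1).

Definition mnorm v : int := `|\det (symmx v)|.

Definition Cand v (z : 'cV[int]_n) : Prop :=
  z != 0 /\ exists q : 'I_n -> rat,
    (forall i, `|q i| < 1) /\
    map_mx (intr : int -> rat) z =
      \sum_(i < n) q i *: map_mx (intr : int -> rat) (val (v i)).

(* x = g y as modular symbols, where a symbol is taken up to the order of its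
   entries and their signs; [v_1, v_2, ..] and - [v_1, v_2, ..] = [v_2, v_1, ..] are
   not distinguished. *)
Definition translate (g : 'M[int]_n) x y : Prop :=
  exists t : 'S_n, forall i,
    val (x i) = g *m val (y (t i)) \/ val (x i) = - (g *m val (y (t i))).

(* v is a submodular symbol, of norm > 1, of a 1-sharbly in the support of xi *)
Definition large_sub (xi : chain (pvec n) n.+1) v : Prop :=
  1 < mnorm v /\
  exists u k, u \in dom xi /\ translate 1%:M v (face k u).

(* The candidates are primitive, as w is pvec-valued: they become entries of
   sharblies. *)
Definition equivariant_choice (Gamma : 'M[int]_n -> Prop)
    (xi : chain (pvec n) n.+1) (w : sym (pvec n) n -> pvec n) : Prop :=
  (forall v, large_sub xi v -> Cand v (val (w v))) /\
  (forall g v v', Gamma g -> large_sub xi v -> large_sub xi v' ->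
     translate g v v' -> val (w v) = g *m val (w v')).

Definition nlarge u : nat := #|[set k : 'I_n.+1 | 1 < mnorm (face k u)]|.

Definition well_ordered u : Prop :=
  forall k : 'I_n.+1, (k < nlarge u)%N = (1 < mnorm (face k u)).

End ModularSymbols.

(* The polytope P_j, the convex hull of e_1, .., e_n+1, - e_1, .., - e_j. *)

Section Polytope.
Variables (R : realType) (n : nat).

(* (k, false) stands for e_k and (k, true) for - e_k *)
Definition vtx : Type := ('I_n.+1 * bool)%type.

Definition pt (p : vtx) : 'rV[R]_n.+1 := (-1) ^+ p.2 *: delta_mx ord0 p.1.

Definition vertices (j : nat) : {set vtx} :=
  [set p : vtx | p.2 ==> (p.1 < j)%N].

Definition hull (s : {set vtx}) (a : 'rV[R]_n.+1) : Prop :=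
  exists c : vtx -> R,
    [/\ forall p, 0 <= c p, \sum_(p in s) c p = 1 &
        a = \sum_(p in s) c p *: pt p].

Definition aff_indep (s : {set vtx}) : Prop :=
  forall c : vtx -> R, \sum_(p in s) c p = 0 ->
    \sum_(p in s) c p *: pt p = 0 -> forall p, p \in s -> c p = 0.

(* T is the set of maximal simplices, given by their vertices.  The dimension
   of P_j is n + 1 for j > 0; P_0 is an n-simplex, subdivided by itself only. *)
Definition subdivision (j : nat) (T : {set {set vtx}}) : Prop :=
  [/\ forall s, s \in T ->
        [/\ s \subset vertices j, aff_indep s & #|s| = (n.+1 + (0 < j))%N],
      forall a, hull (vertices j) a -> exists2 s, s \in T & hull s a &
      forall s t a, s \in T -> t \in T ->
        hull s a -> hull t a -> hull (s :&: t) a].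

(* Order compatible with the orientation of P_j, which is the standard one of
   R^(n+1).  Indeed, for q in P_j off the facet F = {e_1, .., e_n+1}, the
   determinant of (q, e_1, .., e_n+1) below is 1 - \sum_i q_i > 0, and bdry gives
   [e_1, .., e_n+1] the coefficient -1 in bdry [q, e_1, .., e_n+1]: the
   orientation of F induced through bdry is opposite to its ordering. *)
Definition positive_order (x : sym vtx n.+2) : Prop :=
  0 < \det (\matrix_(i < n.+1) (pt (x (lift ord0 i)) - pt (x ord0))).

Definition oriented_by (T : {set {set vtx}}) (o : {set vtx} -> sym vtx n.+2)
    : Prop :=
  forall s, s \in T -> #|s| = n.+2 ->
    [set o s i | i in 'I_n.+2] = s /\ positive_order (o s).

End Polytope.

Section Eta.
Variable n : nat.
Implicit Types (u : sym (pvec n) n.+1) (w : sym (pvec n) n -> pvec n).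

(* The fundamental chain of the subdivision T.  It is 0 when T consists of the
   n-simplex P_0, which has no simplex with n + 2 vertices. *)
Definition fund_chain (T : {set {set vtx n}}) (o : {set vtx n} -> sym (vtx n) n.+2)
    : chain (vtx n) n.+2 :=
  \sum_(s in T | #|s| == n.+2) << o s >>.

(* e_k is labelled v_k and - e_k is labelled w_k = w(v^k). *)
Definition label w u (p : vtx n) : pvec n :=
  if p.2 then w (face p.1 u) else u p.1.

Definition eta w u T o : chain (pvec n) n.+2 := push (label w u) (fund_chain T o).

Definition eta_new w u T o : chain (pvec n) n.+1 :=
  bdry (eta w u T o) - old_part u
  - side_part (nlarge u) u (fun k => w (face k u)).

(* The same as eta_new, before the vertices are replaced by their labels. *)
Definition simplicial_new (j : nat) T o : chain (vtx n) n.+1 :=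
  let e : sym (vtx n) n.+1 := [ffun k => (k, false)] in
  bdry (fund_chain T o) - old_part e - side_part j e (fun k => (k, true)).

End Eta.

(* Main.v *)
(** [xi' = xi + bdry eta] is homologous to [xi] by construction.  For the second
claim, the old parts cancel [xi], and the side parts add up to the image of
[bdry xi] under the cone [[v_1, .., v_n] |-> [v_1, .., v_n, w(v)]], extended
Gamma-equivariantly to the orbits of the large submodular symbols and by 0
elsewhere.  Equivariance of [w] makes this cone well defined on coinvariants,
so the side parts vanish there because [xi] is a cycle.

For the third claim, n + 2 affinely independent vertices of P_j contain exactly
one antipodal pair, hence their hull contains the origin; as simplices meet
along faces, the pair {e_k, - e_k} is the same for all of them.  The subdivision
therefore consists of the joins of - e_k with the simplices (+- e_1, .., e_k, ..),
and its oriented boundary can be computed: old and side parts drop out, and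
every remaining face without a vertex - e_l is {e_i, i <> l} with l > j, whose
label has norm at most 1. *)

From HB Require Import structures.
Require Import Defs.
From mathcomp Require Import all_boot all_order all_algebra.
From mathcomp Require Import perm boolp reals.
Import Order.TTheory GRing.Theory Num.Theory.
Local Open Scope ring_scope.

Set Implicit Arguments.
Unset Strict Implicit.
Unset Printing Implicit Defensive.

(** * Congruences modulo a generated subgroup *)

Section ZSpan.
Variables (V : zmodType) (G : V -> Prop).

Lemma zspanN x : zspan G x -> zspan G (- x).
Proof. by move=> Gx; rewrite -sub0r; apply: zspanB => //; apply: zspan0. Qed.

Lemma zspanD x y : zspan G x -> zspan G y -> zspan G (x + y).
Proof. by move=> Gx Gy; rewrite -[y]opprK; apply/zspanB/zspanN. Qed.

Lemma zspan_sum I (r : seq I) (P : pred I) (F : I -> V) :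
  (forall i, P i -> zspan G (F i)) -> zspan G (\sum_(i <- r | P i) F i).
Proof.
by move=> GF; elim/big_rec: _ => [|i x /GF /zspanD]; [apply: zspan0|apply].
Qed.

Lemma zspan_refl x : zspan G (x - x).
Proof. by rewrite subrr; apply: zspan0. Qed.

Lemma zspan_sym x y : zspan G (x - y) -> zspan G (y - x).
Proof. by move/zspanN; rewrite opprB. Qed.

Lemma zspan_trans y x z :
  zspan G (x - y) -> zspan G (y - z) -> zspan G (x - z).
Proof. by move=> xy /(zspanD xy); rewrite addrA subrK. Qed.

Lemma zspan_add x x' y y' :
  zspan G (x - x') -> zspan G (y - y') -> zspan G (x + y - (x' + y')).
Proof. by move=> /zspanD xx' /xx'; rewrite opprD addrACA. Qed.

Lemma zspan_sumB I (r : seq I) (P : pred I) (F F' : I -> V) :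
  (forall i, P i -> zspan G (F i - F' i)) ->
  zspan G (\sum_(i <- r | P i) F i - \sum_(i <- r | P i) F' i).
Proof. by move=> /zspan_sum-/(_ r); rewrite sumrB. Qed.

End ZSpan.

Lemma zspanZ (V : lmodType int) (G : V -> Prop) (k : int) x :
  zspan G x -> zspan G (k *: x).
Proof.
move=> Gx; rewrite -[k]intz scaler_int.
have Gn m : zspan G (x *+ m).
  by elim: m => [|m IH]; [apply: zspan0 | rewrite mulrS; apply: zspanD].
by case: k => m; rewrite ?NegzE ?mulrNz; [apply: Gn|apply/zspanN/Gn].
Qed.

Lemma zspanZB (V : lmodType int) (G : V -> Prop) (k : int) x y :
  zspan G (x - y) -> zspan G (k *: x - k *: y).
Proof. by rewrite -scalerBr; apply: zspanZ. Qed.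

Lemma zspan_lift (V W : zmodType) (G : V -> Prop) (H : W -> Prop)
    (f : {additive V -> W}) x :
  (forall x, G x -> zspan H (f x)) -> zspan G x -> zspan H (f x).
Proof.
move=> fG; elim=> [|y /fG //|y z _ Hy _ Hz].
  by rewrite raddf0; apply: zspan0.
by rewrite raddfB; apply: zspanB.
Qed.

Lemma zspan_mono (V : zmodType) (G H : V -> Prop) x :
  (forall x, G x -> zspan H x) -> zspan G x -> zspan H x.
Proof. exact: (@zspan_lift _ _ _ _ idfun). Qed.

(** * Chains and alternation *)

Section Lift.
Variables (K : choiceType) (M : lmodType int) (f : K -> M).

HB.instance Definition _ :=
  GRing.isAdditive.Build {freeg K} M (fglift f) (lift_is_additive f).

Fact fglift_is_scalable : scalable (fglift f).
Proof. by move=> k c; rewrite -[k]intz !scaler_int raddfMz. Qed.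

HB.instance Definition _ :=
  GRing.isScalable.Build int {freeg K} M _ (fglift f) fglift_is_scalable.

Lemma fgliftU x : fglift f << x >> = f x.
Proof. by rewrite liftU scale1r. Qed.

End Lift.

Lemma freeg_sumZ (K : choiceType) (c : {freeg K}) :
  c = \sum_(x <- dom c) coeff x c *: << x >>.
Proof.
rewrite -[LHS]freeg_sumE; apply: eq_bigr => x _.
by rewrite -[coeff x c]intz scaler_int freeg_mulz intz.
Qed.

HB.instance Definition _ (A : choiceType) m :=
  GRing.Linear.copy (@bdry A m) (fglift _).
HB.instance Definition _ (A B : choiceType) (f : A -> B) m :=
  GRing.Linear.copy (@push A B f m) (fglift _).

Definition sym_map (A B : choiceType) (f : A -> B) m (x : sym A m) : sym B m :=
  [ffun i => f (x i)].

Lemma bdryU (A : choiceType) m (x : sym A m.+1) :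
  bdry << x >> = \sum_(k < m.+1) (-1 : int) ^+ k.+1 *: << face k x >>.
Proof. exact: fgliftU. Qed.

Lemma pushU (A B : choiceType) (f : A -> B) m (x : sym A m) :
  push f << x >> = << sym_map f x >>.
Proof. exact: fgliftU. Qed.

Lemma chain_ext (A : choiceType) m (W : lmodType int)
    (f g : {linear chain A m -> W}) c :
  (forall x, f << x >> = g << x >>) -> f c = g c.
Proof.
move=> fg; rewrite (freeg_sumZ c) !linear_sum; apply: eq_bigr => x _.
by rewrite !linearZ /= fg.
Qed.

Lemma face_sym_map (A B : choiceType) (f : A -> B) m k (x : sym A m.+1) :
  face k (sym_map f x) = sym_map f (face k x).
Proof. by apply/ffunP => i; rewrite !ffunE. Qed.

Lemma reord_sym_map (A B : choiceType) (f : A -> B) m (x : sym A m) t :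
  reord (sym_map f x) t = sym_map f (reord x t).
Proof. by apply/ffunP => i; rewrite !ffunE. Qed.

Lemma push_bdry (A B : choiceType) (f : A -> B) m (c : chain A m.+1) :
  push f (bdry c) = bdry (push f c).
Proof.
have := @chain_ext _ _ _ (@push _ _ f m \o @bdry A m)
  (@bdry B m \o @push _ _ f m.+1) c.
apply=> x /=.
rewrite bdryU pushU bdryU linear_sum; apply: eq_bigr => k _.
by rewrite linearZ /= pushU face_sym_map.
Qed.

Section Alternating.
Variable A : choiceType.

Lemma alt_reord m (x : sym A m) (t : 'S_m) :
  alt_eq << x >> ((-1 : int) ^+ t *: << reord x t >>).
Proof. by apply: zspan_gen; exists x, t. Qed.

Lemma alt_reordV m (x : sym A m) (t : 'S_m) :
  alt_eq << reord x t >> ((-1 : int) ^+ t *: << x >>).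
Proof.
have := zspanZ ((-1) ^+ t) (alt_reord x t).
by rewrite scalerBr scalerA -signr_addb addbb scale1r => /zspan_sym.
Qed.

Lemma face_reord m (x : sym A m.+1) k l (t : 'S_m) :
  face k (reord x (lift_perm k l t)) = reord (face l x) t.
Proof. by apply/ffunP => i; rewrite !ffunE lift_perm_lift. Qed.

Lemma append_reord m (x : sym A m) a (t : 'S_m) :
  append (reord x t) a = reord (append x a) (lift_perm ord_max ord_max t).
Proof.
apply/ffunP => i; rewrite !ffunE; case: unliftP => [l|] ->.
  by rewrite lift_perm_lift liftK ffunE.
by rewrite lift_perm_id unlift_none.
Qed.

Lemma reord_of_image m (x y : sym A m) :
  injective x -> (forall i, exists i', x i = y i') -> exists t, x = reord y t.
Proof.
move=> x_inj /boolp.choice[f fE].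
have f_inj : injective f by move=> i j fij; apply: x_inj; rewrite !fE fij.
by exists (perm f_inj); apply/ffunP => i; rewrite ffunE permE.
Qed.

(** Removing [k] from the source and [t k] from the target of [t] leaves a permutation of the
    remaining positions. It is the one by which the faces of a reordered symbol are reordered. *)
Lemma lift_permP m (t : 'S_m.+1) k : exists t', t = lift_perm k (t k) t'.
Proof.
have h i : unlift (t k) (t (lift k i)).
  by case: unliftP => //= /perm_inj /eqP; rewrite eq_sym (negPf (neq_lift _ _)).
pose f i := odflt i (unlift (t k) (t (lift k i))).
have fE i : lift (t k) (f i) = t (lift k i).
  by rewrite /f; case: unliftP (h i) => //= j ->.
have f_inj : injective f.
  by move=> i i' /(congr1 (lift (t k))); rewrite !fE => /perm_inj/lift_inj.
exists (perm f_inj); apply/permP => i; case: (unliftP k i) => [l|] ->.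
  by rewrite lift_perm_lift permE fE.
by rewrite lift_perm_id.
Qed.

(** The [k]-th face of [reord x t] is the [t k]-th face of [x] reordered by the restriction [t'] of
    [t], and sign(t) = (-1)^(k + t k) sign(t'). Reindexing the boundary by [t] therefore matches the
    two sums term by term. *)
Lemma alt_eq_bdry m (c d : chain A m.+1) :
  alt_eq c d -> alt_eq (bdry c) (bdry d).
Proof.
rewrite /alt_eq -linearB; apply: (zspan_lift (f := @bdry A m)) => _ [x [t ->]] /=.
rewrite linearB linearZ /= !bdryU scaler_sumr (reindex_inj (@perm_inj _ t)).
apply: zspan_sumB => k _; rewrite scalerA.
have [t' tE] := lift_permP t k.
have -> : face k (reord x t) = reord (face (t k) x) t'.
  by rewrite {1}tE face_reord.
have := zspanZ ((-1) ^+ (t k).+1) (alt_reord (face (t k) x) t').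
rewrite scalerBr scalerA.
suff -> : (-1) ^+ t * (-1) ^+ k.+1 = (-1) ^+ (t k).+1 * (-1) ^+ t' :> int by [].
rewrite [in odd_perm t]tE odd_lift_perm 2!signr_addb 2!signr_odd !exprS.
set a := _ ^+ k; set b := _ ^+ t k; set e := _ ^+ nat_of_bool t'.
have aa : a * a = 1 by rewrite -expr2 sqrr_sign.
by rewrite mulrC -!mulrA [a * (a * _)]mulrA aa mul1r.
Qed.

Lemma alt_eq_push (B : choiceType) (f : A -> B) m (c d : chain A m) :
  alt_eq c d -> alt_eq (push f c) (push f d).
Proof.
rewrite /alt_eq -linearB; apply: (zspan_lift (f := @push _ _ f m)) => _ [x [t ->]] /=.
rewrite linearB linearZ /= !pushU; apply: zspan_gen; exists (sym_map f x), t.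
by rewrite reord_sym_map.
Qed.

Definition prepend m (a : A) (x : sym A m) : sym A m.+1 :=
  [ffun i => if unlift ord0 i is Some l then x l else a].

Definition replace_at m (k : 'I_m) (a : A) (x : sym A m) : sym A m :=
  [ffun i => if i == k then a else x i].

(** Moving the last entry back to position [k] is a cycle through m - k + 1 positions, of sign
    (-1)^(m - k). *)
Lemma alt_append m (k : 'I_m.+1) (a : A) (x : sym A m.+1) :
  alt_eq ((-1 : int) ^+ (m - k) *: << append (face k x) a >>) << replace_at k a x >>.
Proof.
have -> : append (face k x) a = reord (replace_at k a x) (lift_perm ord_max k 1).
  apply/ffunP => i; rewrite !ffunE; case: unliftP => [l|] ->.
    by rewrite lift_perm_lift perm1 ffunE eq_sym (negPf (neq_lift _ _)).
  by rewrite lift_perm_id eqxx.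
apply: zspan_sym; have := alt_reord (replace_at k a x) (lift_perm ord_max k 1).
rewrite odd_lift_perm odd_perm1 addbF -oddB ?signr_odd //; exact: ltnSE (ltn_ord k).
Qed.

Lemma alt_prepend m (k : 'I_m.+1) (a : A) (x : sym A m.+1) :
  alt_eq ((-1 : int) ^+ k *: << prepend a (face k x) >>) << replace_at k a x >>.
Proof.
have -> : prepend a (face k x) = reord (replace_at k a x) (lift_perm ord0 k 1).
  apply/ffunP => i; rewrite !ffunE; case: unliftP => [l|] ->.
    by rewrite lift_perm_lift perm1 ffunE eq_sym (negPf (neq_lift _ _)).
  by rewrite lift_perm_id eqxx.
apply: zspan_sym; have := alt_reord (replace_at k a x) (lift_perm ord0 k 1).
by rewrite odd_lift_perm odd_perm1 addbF addFb signr_odd.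
Qed.

Lemma bdry_prepend m (a : A) (x : sym A m.+1) :
  bdry << prepend a x >> =
  - << x >> + \sum_(k < m.+1) (-1 : int) ^+ k *: << prepend a (face k x) >>.
Proof.
rewrite bdryU big_ord_recl; congr (_ + _).
  (* Face 0 drops the apex and carries the sign -1; each other face keeps the apex, and its index is
     shifted by one. *)
  rewrite expr1 scaleN1r; suff -> : face ord0 (prepend a x) = x by [].
  by apply/ffunP => i; rewrite !ffunE liftK.
apply: eq_bigr => k _; rewrite !exprS mulrA mulrNN !mul1r.
suff -> : face (lift ord0 k) (prepend a x) = prepend a (face k x) by [].
apply/ffunP => i; rewrite !ffunE.
case: (unliftP ord0 i) => [l|] ->.
  have -> : lift (lift ord0 k) (lift ord0 l) = lift ord0 (lift k l).
    by apply: val_inj; rewrite /= /bump !leq0n !add1n ltnS addnS.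
  by rewrite liftK ffunE.
have -> : lift (lift ord0 k) ord0 = ord0 by apply: val_inj.
by rewrite unlift_none.
Qed.

End Alternating.

(** * Coinvariants *)

Section Translate.
Variable n : nat.
Implicit Types (g h : 'M[int]_n) (x y z : sym (pvec n) n).

Lemma translate_refl x : translate 1%:M x x.
Proof. by exists 1%g => i; rewrite perm1 mul1mx; left. Qed.

Lemma translate_reord x (t : 'S_n) : translate 1%:M (reord x t) x.
Proof. by exists t => i; rewrite ffunE mul1mx; left. Qed.

Lemma translate_trans g h y x z :
  translate g x y -> translate h y z -> translate (g *m h) x z.
Proof.
move=> [t xy] [t' yz]; exists (t * t')%g => i; rewrite permM -mulmxA.
by case: (xy i) (yz (t i)) => -> [] ->; rewrite ?mulmxN ?opprK; [left|right|right|left].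
Qed.

Lemma translate_inv g x y :
  g \in unitmx -> translate g x y -> translate (invmx g) y x.
Proof.
move=> gu [t xy]; exists t^-1%g => i.
by case: (xy (t^-1 i))%g => ->; rewrite permKV ?mulmxN mulKmx ?opprK //; [left|right].
Qed.

Lemma norm_det_unitmx g : g \in unitmx -> `|\det g| = 1.
Proof. by rewrite unitmxE => /orP[] /eqP ->; rewrite ?normrN normr1. Qed.

(** The matrix of [x] is that of [y] multiplied by [g], a permutation matrix and a diagonal matrix
    of signs, all of determinant 1 or -1. *)
Lemma mnorm_translate g x y : g \in unitmx -> translate g x y -> mnorm x = mnorm y.
Proof.
move=> gu [t xy].
pose d : 'rV[int]_n := \row_i (-1) ^+ (val (x i) != g *m val (y (t i))).
have -> : mnorm x = `|\det (g *m col_perm t (symmx y) *m diag_mx d)|.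
  suff /(congr1 (fun A => `|\det A|)) :
    symmx x = g *m col_perm t (symmx y) *m diag_mx d by [].
  apply/matrixP => i l.
  rewrite mul_mx_diag !mxE.
  have -> : \sum_j g i j * col_perm t (symmx y) j l = (g *m val (y (t l))) i ord0.
    by rewrite mxE; apply: eq_bigr => j _; rewrite !mxE.
  have [->|ne] := eqVneq; first by rewrite mulr1.
  by case: (xy l) ne => ->; rewrite ?eqxx // => _; rewrite mxE mulrN1.
rewrite !det_mulmx !normrM norm_det_unitmx // mul1r det_diag normr_prod.
rewrite [X in _ * X]big1 => [|i _]; last by rewrite mxE normr_sign.
by rewrite mulr1 col_permE det_mulmx det_perm normrM normr_sign mulr1.
Qed.

Lemma mnorm_rank x : 1 < mnorm x ->
  \rank (map_mx (intr : int -> rat) (symmx x)) = n.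
Proof.
move=> x1; apply/eqP; rewrite -/(row_free _) row_free_unit unitmxE unitfE.
rewrite det_map_mx intr_eq0.
by apply: contraTneq x1; rewrite /mnorm => ->; rewrite normr0.
Qed.

(** A common divisor of the coordinates of [g *m v] divides those of [v], since these are integral
    combinations of them through the inverse of [g]. *)
Lemma pvec_mul g (v : pvec n) : g \in unitmx ->
  exists v' : pvec n, val v' = g *m val v.
Proof.
move=> gu; suff gv : primitive (g *m val v) by exists (Sub _ gv); rewrite SubK.
rewrite /primitive; set d := \big[_/_]_(i < n) _.
rewrite -dvdn1 -[X in (_ %| X)%N](eqP (valP v)); apply/dvdn_biggcdP => i _.
rewrite -[val v](mulKmx gu) mxE.
suff : (d%:Z %| \sum_j invmx g i j * (g *m val v) j ord0)%Z by [].
apply: rpred_sum => j _; apply: dvdz_mull.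
exact: (biggcdn_inf j).
Qed.

End Translate.

Lemma translate_face_reord n (u : sym (pvec n) n.+1) (t : 'S_n.+1) k :
  translate 1%:M (face k (reord u t)) (face (t k) u).
Proof.
have [t' ->] := lift_permP t k; rewrite face_reord lift_perm_id.
exact: translate_reord.
Qed.

(** * The equivariant cone operator and the cancellation of the side parts *)

Section Coinvariants.
Variables (n : nat) (Gamma : 'M[int]_n -> Prop) (xi : chain (pvec n) n.+1)
  (w : sym (pvec n) n -> pvec n).
Hypothesis Gamma_group :
  subgroup_of (@SLZ n) Gamma \/ subgroup_of (@GLZ n) Gamma.
Hypothesis w_equi : equivariant_choice Gamma xi w.

Lemma Gamma_unit g : Gamma g -> g \in unitmx.
Proof.
case: Gamma_group => -[sub _ _ _] /sub //.
by rewrite unitmxE => ->; rewrite unitr1.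
Qed.

Lemma Gamma1 : Gamma 1%:M. Proof. by case: Gamma_group => -[]. Qed.
Lemma GammaM g h : Gamma g -> Gamma h -> Gamma (g *m h).
Proof. by case: Gamma_group => -[_ _ + _]; apply. Qed.
Lemma GammaV g : Gamma g -> Gamma (invmx g).
Proof. by case: Gamma_group => -[_ _ _]; apply. Qed.

(** The apex that equivariance forces over [x]: the candidate of a large submodular symbol in the
    orbit of [x], carried along. It is a relation at first because [g] and [v] are not determined by
    [x]. *)
Definition transported (x : sym (pvec n) n) (z : pvec n) : Prop :=
  exists g v, [/\ Gamma g, large_sub xi v, translate g x v & val z = g *m val (w v)].

(** If [g] carries [v] and [g'] carries [v'] to the same [x], then the product of the inverse of [g]
    with [g'] carries [v'] to [v], and equivariance of [w] compares the two candidates. *)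
Lemma transported_inj x z z' : transported x z -> transported x z' -> z = z'.
Proof.
move=> [g [v [Gg lv xv zE]]] [g' [v' [Gg' lv' xv' zE']]]; apply: val_inj.
have gu := Gamma_unit Gg.
have vv' := translate_trans (translate_inv gu xv) xv'.
have := w_equi.2 _ _ _ (GammaM (GammaV Gg) Gg') lv lv' vv'.
by rewrite zE zE' => ->; rewrite -mulmxA mulKVmx.
Qed.

Lemma transported_translate h x y z z' : Gamma h -> translate h y x ->
  val z' = h *m val z -> transported x z -> transported y z'.
Proof.
move=> Gh yx zz' [g [v [Gg lv xv zE]]]; exists (h *m g), v; split=> //.
- exact: GammaM.
- exact: translate_trans xv.
- by rewrite zz' zE mulmxA.
Qed.

Lemma transported_mnorm x z : transported x z -> 1 < mnorm x.
Proof. by move=> [g [v [/Gamma_unit gu [v1 _] /mnorm_translate-> //]]]. Qed.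

Lemma transported_large x : large_sub xi x -> transported x (w x).
Proof.
move=> lx; exists 1%:M, x; split=> //; rewrite ?mul1mx //; first exact: Gamma1.
exact: translate_refl.
Qed.

Lemma transported_option x :
  exists oz, forall z, oz = Some z <-> transported x z.
Proof.
have [[z xz]|no] := pselect (exists z, transported x z).
  by exists (Some z) => z'; split=> [[<-] //|/(transported_inj xz)->].
by exists None => z; split=> // xz; case: no; exists z.
Qed.

Definition coned (x : sym (pvec n) n) : option (pvec n) :=
  projT1 (cid (transported_option x)).

Lemma conedP x z : coned x = Some z <-> transported x z.
Proof. exact: (projT2 (cid (transported_option x))). Qed.

Lemma coned_translate h x y : Gamma h -> translate h y x ->
  match coned x, coned y with
  | Some z, Some z' => val z' = h *m val z
  | None, None => True
  | _, _ => False
  end.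
Proof.
move=> Gh yx; have hu := Gamma_unit Gh.
case xE: (coned x) => [z|].
  have /conedP xz := xE.
  have [z' z'E] := pvec_mul z hu.
  by have /conedP -> := transported_translate Gh yx z'E xz.
(* An apex over [y] would be carried back to one over [x] by the inverse of [h]. *)
case yE: (coned y) => [z|] //.
have /conedP yz := yE.
have [z' z'E] := pvec_mul z (Gamma_unit (GammaV Gh)).
have /conedP := transported_translate (GammaV Gh) (translate_inv hu yx) z'E yz.
by rewrite xE.
Qed.

Lemma coned_translate1 x y : translate 1%:M y x -> coned y = coned x.
Proof.
move=> /(coned_translate Gamma1); case: (coned x) (coned y) => [z|] [z'|] //.
by rewrite mul1mx => /val_inj->.
Qed.

Definition cone : chain (pvec n) n -> chain (pvec n) n.+1 :=
  fglift (fun x : sym _ _ => if coned x is Some z then << append x z >> else 0).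

HB.instance Definition _ := GRing.Linear.copy cone (fglift _).

Lemma coneU x : cone << x >> = if coned x is Some z then << append x z >> else 0.
Proof. exact: fgliftU. Qed.

Definition coinvariant_rel m (z : chain (pvec n) m) : Prop :=
  sharbly_rel z \/ coinv_rel Gamma z.

(** The cone descends to coinvariants. Permutations and sign changes extend to the appended symbol
    because the apex comes last and depends only on the symbol up to order and signs; a symbol of
    deficient rank has norm 0, so it has no apex; and [Gamma] moves the apex together with the
    symbol. *)
Lemma cone_rel c : coinvariant_rel c -> zspan (@coinvariant_rel n.+1) (cone c).
Proof.
case=> [[[x [t ->]]|[x [y [yx ->]]]|[x [rx ->]]]|[g [x [y [Gg yx ->]]]]].
- rewrite linearB linearZ /= !coneU (coned_translate1 (translate_reord x t)).
  case: coned => [z|]; last by rewrite scaler0; apply: zspan_refl.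
  apply: zspan_gen; left; apply: Or31.
  exists (append x z), (lift_perm ord_max ord_max t); rewrite append_reord.
  by rewrite odd_lift_perm addbb addFb.
- rewrite linearB /= !coneU; have -> : coned y = coned x.
    apply: coned_translate1; exists 1%g => i; rewrite perm1 mul1mx.
    by case: (yx i) => [|[]]; [left|right].
  case: coned => [z|]; last exact: zspan_refl.
  apply: zspan_gen; left; apply: Or32; exists (append x z), (append y z).
  split=> // i; rewrite !ffunE; case: unliftP => [l ->|_]; last by left.
  by case: (yx l) => [|[l0 ->]]; [left|right; rewrite lift_max].
- rewrite coneU; case xE: coned => [z|]; last exact: zspan0.
  by move: rx; rewrite mnorm_rank ?ltnn //; apply/transported_mnorm/conedP/xE.
- rewrite linearB /= !coneU.
  have gyx : translate g y x by exists 1%g => i; rewrite perm1; left.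
  have := coned_translate Gg gyx; case: (coned x) (coned y) => [z|] [z'|] //.
    move=> zz'; apply: zspan_gen; right; exists g, (append x z), (append y z').
    by split=> // i; rewrite !ffunE; case: unliftP.
  by move=> _; apply: zspan_refl.
Qed.

(** A face of norm > 1 is itself a large submodular symbol, so its apex is its own candidate; any
    other face has no apex, as symbols with an apex have norm > 1. The signs (-1)^(k+1) of the
    boundary and (-1)^(n-k) of the side part differ by the constant (-1)^(n+1). *)
Lemma cone_bdry u (t : 'S_n.+1) : u \in dom xi -> well_ordered (reord u t) ->
  let v := reord u t in
  side_part (nlarge v) v (fun k => w (face k v)) =
    (-1 : int) ^+ n.+1 *: cone (bdry << v >>).
Proof.
move=> uxi wo v; rewrite bdryU linear_sum scaler_sumr /side_part big_mkcond.
apply: eq_bigr => k _; rewrite wo linearZ /= coneU -/v.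
case: ifPn => [k1|k1].
  have lk : large_sub xi (face k v).
    split=> //; exists u, (t k); split=> //; exact: translate_face_reord.
  have /conedP -> := transported_large lk.
  rewrite scalerA -exprD -signr_odd -[in RHS]signr_odd addSn addnS /= negbK.
  by rewrite oddD oddB //; apply: ltnSE (ltn_ord k).
case kE: coned => [z|]; last by rewrite !scaler0.
by case/negP: k1; apply: transported_mnorm; apply/conedP/kE.
Qed.

Lemma alt_coinv m (c d : chain (pvec n) m) : alt_eq c d -> coinv_eq Gamma c d.
Proof. by apply: zspan_mono => x rx; apply: zspan_gen; left; apply: Or31. Qed.

Variable s : sym (pvec n) n.+1 -> 'S_n.+1.
Hypothesis xi_cycle : coinv_eq Gamma (bdry xi) 0.
Hypothesis s_well : forall u, u \in dom xi -> well_ordered (reord u (s u)).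

Lemma reorder_chain :
  alt_eq xi (\sum_(u <- dom xi) ((-1) ^+ s u * coeff u xi) *: << reord u (s u) >>).
Proof.
rewrite /alt_eq [X in X - _]freeg_sumZ; apply: zspan_sumB => u _.
by rewrite mulrC -scalerA; apply: zspanZB; apply: alt_reord.
Qed.

(** Summed over the support, the side parts are, up to sign, the cone over the boundary of the
    reordered [xi]. That boundary vanishes in the coinvariants, and the cone respects their
    relations. *)
Lemma side_cancel :
  coinv_eq Gamma 0
    (\sum_(u <- dom xi) ((-1) ^+ s u * coeff u xi) *:
       side_part (nlarge (reord u (s u))) (reord u (s u))
         (fun k => w (face k (reord u (s u))))).
Proof.
pose xo := \sum_(u <- dom xi) ((-1) ^+ s u * coeff u xi) *: << reord u (s u) >>.
rewrite big_seq (eq_bigr (fun u => (-1) ^+ n.+1 *: cone (bdry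
  (((-1) ^+ s u * coeff u xi) *: << reord u (s u) >>)))) => [|u uxi]; last first.
  rewrite !linearZ /= cone_bdry //; last exact: s_well.
rewrite -big_seq -scaler_sumr -!linear_sum -/xo.
rewrite /coinv_eq sub0r; apply/zspanN/zspanZ/(zspan_lift cone_rel).
rewrite /= -[bdry xo]subr0; apply: zspan_trans xi_cycle.
by apply/zspan_sym/alt_coinv/alt_eq_bdry/reorder_chain.
Qed.

End Coinvariants.

(** * Simplices of the polytope and their boundaries *)

Section Support.
Variables (K : choiceType) (P : K -> Prop).

Definition supported (c : {freeg K}) : Prop := forall x, x \in dom c -> P x.

Lemma supportedD c d : supported c -> supported d -> supported (c + d).
Proof.
by move=> Pc Pd x /domD_subset; rewrite mem_cat => /orP[/Pc|/Pd].
Qed.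

Lemma supportedN c : supported c -> supported (- c).
Proof. by move=> Pc x; rewrite domN => /Pc. Qed.

Lemma supportedZ k c : supported c -> supported (k *: c).
Proof. by move=> Pc x /domZ_subset /Pc. Qed.

Lemma supportedU x : P x -> supported << x >>.
Proof. by move=> Px y; rewrite domU1 inE => /eqP ->. Qed.

Lemma supported_sum I (r : seq I) (Q : pred I) (F : I -> {freeg K}) :
  (forall i, Q i -> supported (F i)) -> supported (\sum_(i <- r | Q i) F i).
Proof.
move=> PF; elim/big_rec: _ => [x|i c /PF Pi Pc]; first by rewrite dom0.
exact: supportedD.
Qed.

End Support.

(** Pairing [A] with [l |: A] is what makes alternating sums over subsets cancel. *)
Lemma big_powersetD1 (V : nmodType) (I : finType) (K : {set I}) l
    (F : {set I} -> V) : l \in K ->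
  \sum_(A in powerset K) F A = \sum_(A in powerset (K :\ l)) (F A + F (l |: A)).
Proof.
move=> lK; rewrite big_split (bigID (fun A : {set I} => l \in A)) /= addrC.
congr (_ + _).
  by apply: eq_bigl => A; rewrite !inE subsetD1.
rewrite (reindex_onto (fun A => l |: A) (fun A => A :\ l)) => [|A /andP[_ lA]].
  apply: eq_bigl => A; rewrite !inE eqxx subUset sub1set lK subsetD1 /= andbT.
  case: (boolP (l \in A)) => lA; last by rewrite setU1K ?eqxx.
  rewrite andbF; apply/negP => /andP[_ /eqP E].
  by move: lA; rewrite -E !inE eqxx.
exact: setD1K.
Qed.

(** * Joins of [- e_k] with orthant simplices, and their boundary *)

Section Orthants.
Variable n : nat.
Implicit Types (A J : {set 'I_n.+1}) (k l : 'I_n.+1).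

(** The facet of the cross-polytope in the orthant whose negative coordinates are those in [A]. *)
Definition orthant A : sym (vtx n) n.+1 := [ffun l => (l, l \in A)].

(** For [k] outside [A], the vertex set of the join of [- e_k] with the orthant simplex, which
    contains the antipodal point [e_k]. *)
Definition cone_set k A : {set vtx n} :=
  (k, true) |: [set (l, l \in A) | l in 'I_n.+1].

Lemma mem_cone_set k A l b :
  ((l, b) \in cone_set k A) = (b == (l \in A)) || (b && (l == k)).
Proof.
rewrite !inE orbC; congr orb; last by rewrite -pair_eqE /= andbC; case: b.
apply/imsetP/eqP => [[l' _ [-> ->]] //|->]; by exists l.
Qed.

Lemma card_cone_set k A : k \notin A -> #|cone_set k A| = n.+2.
Proof.
move=> kA; rewrite cardsU1 card_imset ?card_ord => [|l l' [] //].
suff -> : (k, true) \notin [set (l, l \in A) | l in 'I_n.+1] by [].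
by apply/imsetP => -[l _ [<-]]; rewrite (negPf kA).
Qed.

Lemma face_orthantU1 l A : face l (orthant (l |: A)) = face l (orthant A).
Proof.
by apply/ffunP => i; rewrite !ffunE !inE eq_sym (negPf (neq_lift _ _)).
Qed.

Lemma replace_at_orthant k A : replace_at k (k, true) (orthant A) = orthant (k |: A).
Proof.
by apply/ffunP => i; rewrite !ffunE !inE; have [->|] := eqVneq i k.
Qed.

Lemma prepend_orthant_image k A :
  [set prepend (k, true) (orthant A) i | i in 'I_n.+2] = cone_set k A.
Proof.
apply/setP => -[l b]; rewrite mem_cone_set; apply/imsetP/idP => [[i _]|].
  rewrite ffunE; case: unliftP => [m _|_ [-> ->]]; last by rewrite eqxx orbT.
  by rewrite ffunE => -[-> ->]; rewrite eqxx.
case/orP => [/eqP ->|/andP[-> /eqP->]].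
  by exists (lift ord0 l) => //; rewrite ffunE liftK ffunE.
by exists ord0 => //; rewrite ffunE unlift_none.
Qed.

(** In each join, dropping the apex gives the orthant of [A], and dropping [e_k] gives that of
    [k |: A]: together these run over all subsets of [J]. Walls opposite the vertex on an axis [l]
    of [J] other than [k] are shared by two joins and cancel. Walls with [l] outside [J] lie on the
    boundary of the polytope and survive. *)
Lemma bdry_cones k J : k \in J ->
  alt_eq
    (\sum_(A in powerset (J :\ k))
       (-1 : int) ^+ #|A| *: bdry << prepend (k, true) (orthant A) >>)
    (- (\sum_(A in powerset J) (-1 : int) ^+ #|A| *: << orthant A >>) +
     \sum_(A in powerset (J :\ k)) (-1 : int) ^+ #|A| *:
        \sum_(l | l \notin J)
          (-1 : int) ^+ l *: << prepend (k, true) (face l (orthant A)) >>).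
Proof.
move=> kJ; rewrite (big_powersetD1 _ kJ).
pose side A l : chain (vtx n) n.+1 :=
  (-1) ^+ l *: << prepend (k, true) (face l (orthant A)) >>.
(* The wall forgets whether [l] lies in [A], while the sign (-1)^#|A| changes with it. *)
have inner : \sum_(A in powerset (J :\ k)) (-1 : int) ^+ #|A| *:
    (\sum_(l in J :\ k) side A l) = 0.
  under eq_bigr do rewrite scaler_sumr.
  rewrite exchange_big big1 //= => l lJ; rewrite (big_powersetD1 _ lJ) big1 // => A.
  rewrite !inE subsetD1 => /andP[_ lA].
  by rewrite cardsU1 lA /side face_orthantU1 exprS mulN1r scaleNr subrr.
rewrite -[X in alt_eq _ (_ + X)]add0r -[X in alt_eq _ (_ + (X + _))]inner.
rewrite -sumrN -!big_split /=; apply: zspan_sumB => A.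
rewrite inE subsetD1 => /andP[_ kA]; rewrite cardsU1 kA exprS mulN1r scaleNr.
rewrite -scalerBr -[- (_ *: _)]scalerN -!scalerDr; apply: zspanZB.
rewrite bdry_prepend opprB [_ - << orthant A >>]addrC -[- _ + _ + (_ + _)]addrA.
apply: zspan_add; first exact: zspan_refl.
rewrite (bigD1 k) //= (bigID (fun l => l \in J)) /=; apply: zspan_add.
  by rewrite -replace_at_orthant; apply: alt_prepend.
rewrite (eq_bigl (mem (J :\ k))) => [|l]; last by rewrite !inE.
rewrite [X in _ + X - _](eq_bigl (fun l => l \notin J)) => [|l].
  exact: zspan_refl.
case: (boolP (l \in J)) => lJ; rewrite ?andbF ?andbT //.
by apply: contraNneq lJ => ->.
Qed.

(** For the orthant sum, the empty set is the old facet and the singletons are the side facets;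
    subsets with at least two elements belong to the new part. *)
Lemma sum_powerset_card1 (V : nmodType) J (F : {set 'I_n.+1} -> V) :
  \sum_(A in powerset J) F A =
  F set0 + \sum_(k in J) F [set k] + \sum_(A in powerset J | (1 < #|A|)%N) F A.
Proof.
rewrite (bigD1 set0) ?inE ?sub0set //= -addrA; congr (_ + _).
rewrite (bigID (fun A : {set _} => (1 < #|A|)%N)) /= addrC; congr (_ + _).
  rewrite -(big_imset F (h := set1)) => [|k l _ _ /set1_inj //].
  apply: eq_bigl => A; rewrite inE -leqNgt -cards_eq0.
  apply/andP/imsetP => [[/andP[AJ A0] A1]|[k kJ ->]].
    have /cards1P[k AE] : #|A| == 1%N by rewrite eqn_leq A1 lt0n.
    by exists k => //; rewrite -sub1set -AE.
  by rewrite sub1set kJ cards1.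
apply: eq_bigl => A; case: ltnP; rewrite ?andbT ?andbF // => A1.
by rewrite -cards_eq0 -lt0n (ltnW A1) andbT.
Qed.

End Orthants.

(** * Orientations of the joins as signs of determinants *)

Section Orientation.
Variables (R : realType) (n : nat).
Implicit Types (A : {set 'I_n.+1}) (x : sym (vtx n) n.+2).

Definition edge_mx x : 'M[R]_n.+1 :=
  \matrix_(i < n.+1) (pt R (x (lift ord0 i)) - pt R (x ord0)).

(** Homogeneous coordinates of the vertices. Here all vertices play the same role, so a reordering
    is a row permutation, whereas [edge_mx] singles out the first vertex. *)
Definition bordered_mx x : 'M[R]_(1 + n.+1) :=
  \matrix_(i < n.+2) row_mx 1%:M (pt R (x i)).

Lemma bordered_mxE x : bordered_mx x =
  block_mx 1%:M (pt R (x ord0)) (const_mx 1) (\matrix_i pt R (x (lift ord0 i))).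
Proof.
apply/matrixP => i j; case: (split_ordP i) => i' ->; case: (split_ordP j) => j' ->;
  rewrite ?block_mxEul ?block_mxEur ?block_mxEdl ?block_mxEdr mxE ?row_mxEl ?row_mxEr.
- by rewrite !ord1.
- by rewrite !ord1; congr (pt R (x _) _ _); apply: val_inj.
- by rewrite !mxE !ord1.
- by rewrite [RHS]mxE; congr (pt R (x _) _ _); apply: val_inj.
Qed.

Lemma det_bordered x : \det (bordered_mx x) = \det (edge_mx x).
Proof.
(* Multiplying by [L] subtracts the first row from the others, which turns points into edge
   vectors. *)
pose L : 'M[R]_(1 + n.+1) := block_mx 1%:M 0 (- const_mx 1) 1%:M.
have -> : \det (bordered_mx x) = \det (L *m bordered_mx x).
  by rewrite det_mulmx det_lblock !det1 !mul1r.
rewrite bordered_mxE mulmx_block !mul1mx !mul0mx !addr0 mulmx1 addNr.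
rewrite det_ublock det1 mul1r; congr (\det _); apply/matrixP => i j.
by rewrite !mxE big_ord1 !mxE mulN1r addrC.
Qed.

Lemma det_edge_mx_reord x (t : 'S_n.+2) :
  \det (edge_mx (reord x t)) = (-1) ^+ t * \det (edge_mx x).
Proof.
rewrite -!det_bordered -det_perm -det_mulmx -row_permE; congr (\det _).
by apply/matrixP => i j; rewrite !mxE ffunE.
Qed.

Lemma det_edge_mx_orthant k A : k \notin A ->
  \det (edge_mx (prepend (k, true) (orthant A))) = (-1) ^+ #|A| * 2.
Proof.
move=> kA; rewrite -det_bordered bordered_mxE.
pose d : 'rV[R]_n.+1 := \row_l (-1) ^+ (l \in A).
have -> : pt R (prepend (k, true) (orthant A) ord0) = - delta_mx ord0 k.
  by rewrite ffunE unlift_none /pt expr1 scaleN1r.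
have -> : \matrix_i pt R (prepend (k, true) (orthant A) (lift ord0 i)) = diag_mx d.
  apply/matrixP => i j; rewrite !mxE ffunE liftK ffunE /= eq_sym.
  by case: eqP; rewrite ?mulr1 ?mulr0.
(* The column operation [U] clears the border because each sign squares to 1. The corner becomes 1 +
   1 = 2, as [k] is not in [A], and the diagonal contributes (-1)^#|A|. *)
pose U : 'M[R]_(1 + n.+1) := block_mx 1%:M 0 (- d^T) 1%:M.
set B := block_mx _ _ _ _; have -> : \det B = \det (B *m U).
  by rewrite det_mulmx det_lblock !det1 !mulr1.
rewrite mulmx_block !mulmx1 !mulmx0 !add0r mulNmx !mulmxN opprK.
have -> : const_mx 1 - diag_mx d *m d^T = 0.
  apply/matrixP => i j; rewrite mul_diag_mx !mxE -expr2 sqrr_sign.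
  exact: subrr.
have -> : delta_mx ord0 k *m d^T = 1%:M :> 'M[R]_1.
  by rewrite -rowE; apply/matrixP => i j; rewrite !mxE (negPf kA) !ord1.
rewrite det_ublock det_diag -raddfD /= det_scalar1 mulrC; congr (_ * _).
rewrite -prodr_const [RHS]big_mkcond; apply: eq_bigr => l _; rewrite mxE.
by case: ifP.
Qed.

(** Two orderings of the same vertices differ by a permutation, whose sign is the quotient of the
    signs of their determinants; the determinant of the join has sign (-1)^#|A|. *)
Lemma alt_positive_order k A x : k \notin A ->
  [set x i | i in 'I_n.+2] = cone_set k A -> positive_order R x ->
  alt_eq << x >> ((-1 : int) ^+ #|A| *: << prepend (k, true) (orthant A) >>).
Proof.
move=> kA xA; rewrite /positive_order -/(edge_mx x).
have /imset_injP x_inj' : #|[set x i | i in 'I_n.+2]| == #|'I_n.+2|.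
  by rewrite xA card_cone_set // card_ord.
have x_inj : injective x by move=> i i'; apply: x_inj'.
have [|t ->] := reord_of_image (y := prepend (k, true) (orthant A)) x_inj.
  move=> i; have : x i \in cone_set k A by rewrite -xA imset_f.
  by rewrite -prepend_orthant_image => /imsetP[i' _]; exists i'.
rewrite det_edge_mx_reord det_edge_mx_orthant // mulrA pmulr_lgt0 ?ltr0n //.
rewrite -[X in _ * X]signr_odd -signr_addb signr_gt0.
rewrite -[X in alt_eq _ (X *: _)]signr_odd negb_add => /eqP <-; exact: alt_reordV.
Qed.

End Orientation.

(** * Classification of the subdivisions of P_j *)

Section Subdivision.
Variables (R : realType) (n : nat).
Implicit Types (s t : {set vtx n}) (A : {set 'I_n.+1}).

Lemma pt_sumE (c : vtx n -> R) s l :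
  (\sum_(p in s) c p *: pt R p) ord0 l =
    (if (l, false) \in s then c (l, false) else 0) -
    (if (l, true) \in s then c (l, true) else 0).
Proof.
rewrite summxE big_mkcond /=.
rewrite (eq_bigr (fun p : vtx n => (fun i b => if (i, b) \in s
    then (c (i, b) *: pt R (i, b)) ord0 l else 0) p.1 p.2)) => [|[] //].
rewrite -(pair_bigA _ (fun i b => if (i, b) \in s
    then (c (i, b) *: pt R (i, b)) ord0 l else 0)) /=.
rewrite (bigD1 l) //= big_bool big1 ?addr0 => [|i il]; rewrite ?big_bool /= !mxE /=.
  rewrite eqxx !mulr1 mulrN1 addrC.
  by case: ((l, true) \in s); rewrite // oppr0.
by rewrite [l == i]eq_sym (negPf il) !mulr0 !if_same addr0.
Qed.

(** Two distinct antipodal pairs have the common midpoint 0, which is an affine dependence among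
    their four points. *)
Lemma aff_indep_pair s k l : aff_indep R s ->
  (k, false) \in s -> (k, true) \in s -> (l, false) \in s -> (l, true) \in s ->
  k = l.
Proof.
move=> ind k0 k1 l0 l1; apply/eqP/negPn/negP => kl.
pose c (p : vtx n) : R := (p.1 == k)%:R - (p.1 == l)%:R.
have cE i b : c (i, b) = (i == k)%:R - (i == l)%:R by [].
have /eqP : c (k, false) = 0.
  apply: (ind c) => //.
    rewrite big_mkcond /= (eq_bigr (fun p : vtx n => (fun i b => if (i, b) \in s
      then c (i, b) else 0) p.1 p.2)) => [|[] //].
    rewrite -(pair_bigA _ (fun i b => if (i, b) \in s then c (i, b) else 0)) /=.
    rewrite (bigD1 k) // (bigD1 l) 1?eq_sym //= !big_bool big1 => [|i /andP[ik il]].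
      rewrite /= k0 k1 l0 l1 !cE !eqxx (negPf kl) eq_sym (negPf kl).
      by rewrite subr0 sub0r addr0 addrACA subrr addr0.
    by rewrite big_bool /= !cE (negPf ik) (negPf il) subr0 !if_same addr0.
  apply/rowP => i; rewrite pt_sumE !cE mxE.
  have [->|ik] := eqVneq i k; first by rewrite k0 k1 subrr.
  have [->|il] := eqVneq i l; first by rewrite l0 l1 subrr.
  by rewrite subr0 !if_same subrr.
by rewrite cE eqxx (negPf kl) subr0 oner_eq0.
Qed.

(** By the pigeonhole principle, n + 2 vertices on n + 1 axes include an antipodal pair, unique by
    affine independence. The set [A] collects the other axes on which the negative vertex occurs. *)
Lemma simplex_cone_set s : aff_indep R s -> #|s| = n.+2 ->
  exists k A, k \notin A /\ s = cone_set k A.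
Proof.
move=> ind cs.
have [k [k0 k1]] : exists k, (k, false) \in s /\ (k, true) \in s.
  apply: contrapT => no; have : #|[set p.1 | p in s]| == #|s|.
    apply/imset_injP => -[i a] [i' b] /= sa sb E; move: sb; rewrite -{i'}E => sb.
    have [<- //|ab] := eqVneq a b; case: no; exists i.
    by case: a b ab sa sb => -[].
  rewrite cs => /eqP E; have := max_card [set p.1 | p in s].
  by rewrite E card_ord ltnn.
have uniq_k l : (l, false) \in s -> (l, true) \in s -> l = k.
  by move=> l0 l1; apply: (aff_indep_pair ind).
pose A := [set l | ((l, true) \in s) && (l != k)].
have kA : k \notin A by rewrite inE eqxx andbF.
exists k, A; split=> //; apply/esym/eqP.
rewrite eqEcard card_cone_set // cs leqnn andbT.
apply/subsetP => -[l b]; rewrite mem_cone_set => /orP[/eqP ->|/andP[-> /eqP -> //]].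
have [-> |lk] := eqVneq l k; first by rewrite (negPf kA).
rewrite inE lk andbT; case: (boolP ((l, true) \in s)) => // l1.
pose s' := s :\ (k, true).
have cs' : #|s'| = n.+1 by apply/eqP; rewrite -eqSS -cs (cardsD1 (k, true) s) k1.
(* Without [- e_k] the n + 1 remaining vertices lie on distinct axes, so every axis is met. *)
have full : [set p.1 | p in s'] = setT.
  apply/eqP; rewrite eqEcard subsetT cardsT card_ord /=.
  suff /eqP-> : #|[set p.1 | p in s']| == #|s'| by rewrite cs'.
  apply/imset_injP => -[i a] [i' b'] /=.
  rewrite !inE => /andP[ka sa] /andP[kb sb] E; move: kb sb; rewrite -{i'}E => kb sb.
  have [<- //|ab] := eqVneq a b'.
  have ik : i = k by case: a b' ab sa sb {ka kb} => -[] // _ *; apply: uniq_k.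
  by case: a b' ka kb ab {sa sb} => -[] //; rewrite ik eqxx.
have : l \in [set p.1 | p in s'] by rewrite full inE.
case/imsetP => -[l' b'] /setD1P[_ sl] /= lE; move: sl; rewrite -{l'}lE.
by case: b' => // sl; rewrite sl in l1.
Qed.

Lemma hull0 s k : (k, false) \in s -> (k, true) \in s -> hull s (0 : 'rV[R]_n.+1).
Proof.
move=> k0 k1; pose c (p : vtx n) : R := if p.1 == k then 2^-1 else 0.
exists c; split.
- by move=> p; rewrite /c; case: ifP => // _; rewrite invr_ge0 ler0n.
- rewrite (bigD1 (k, false)) //= (bigD1 (k, true)) ?k1 ?xpair_eqE ?andbF //=.
  rewrite big1 => [|[i b]].
    by rewrite /c /= eqxx addr0 -[2^-1]mul1r -splitr.
  rewrite /c !xpair_eqE /=; case: eqP => //= _ /andP[/andP[_]].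
  by case: b.
- apply/rowP => i; rewrite pt_sumE mxE /c /=.
  by have [->|_] := eqVneq i k; rewrite ?k0 ?k1 ?if_same subrr.
Qed.

(** Without an antipodal pair, each coordinate of the combination involves a single coefficient. All
    coefficients then vanish, although their sum is 1. *)
Lemma hull0_pair s : hull s (0 : 'rV[R]_n.+1) ->
  exists k, (k, false) \in s /\ (k, true) \in s.
Proof.
move=> [c [c_ge0 c1 /rowP c0]]; apply: contrapT => no.
suff : \sum_(p in s) c p = 0 by rewrite c1 => /eqP; rewrite oner_eq0.
apply: big1 => -[i b] sb; have := c0 i; rewrite pt_sumE mxE.
case: (boolP ((i, false) \in s)) => i0; case: (boolP ((i, true) \in s)) => i1.
- by case: no; exists i.
- by case: b sb i1 => [-> //|_ _]; rewrite subr0.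
- by case: b sb i0 => [_ _|-> //]; rewrite sub0r => /esym /eqP; rewrite oppr_eq0 => /eqP.
- by case: b sb i0 i1 => [->|->].
Qed.

Lemma hull_pt s p : p \in s -> hull s (pt R p).
Proof.
move=> ps; exists (fun q => (q == p)%:R); split.
- by move=> q; rewrite ler0n.
- by rewrite (bigD1 p) //= eqxx big1 ?addr0 // => q /andP[_ /negPf ->].
- rewrite (bigD1 p) //= eqxx scale1r big1 ?addr0 // => q /andP[_ /negPf ->].
  by rewrite scale0r.
Qed.

(** Every simplex contains the origin, so any two of them meet in a face that contains it and hence
    share their antipodal pair. Conversely, every join over this pair occurs, because its barycentre
    has to be covered. *)
Lemma subdivisionP j (T : {set {set vtx n}}) : (0 < j)%N -> subdivision R j T ->
  exists2 k : 'I_n.+1, (k < j)%N &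
    T = [set cone_set k A | A in powerset ([set l : 'I_n.+1 | (l < j)%N] :\ k)].
Proof.
move=> j0 [simp cover inter].
have simpl s : s \in T -> exists k A,
    [/\ k \notin A, s = cone_set k A, (k < j)%N & A \subset [set l : 'I__ | (l < j)%N]].
  move=> /simp[/subsetP sv ind]; rewrite j0 addn1 => cs.
  have [k [A [kA sE]]] := simplex_cone_set ind cs; exists k, A; split=> //.
    have := sv (k, true); rewrite sE mem_cone_set eqxx orbT inE /=.
    exact.
  apply/subsetP => l lA; have := sv (l, true); rewrite sE mem_cone_set lA !inE /=.
  exact.
(* Covering one point of P_j provides a first simplex, which fixes [k]. *)
have /cover[s0 s0T _] : hull (vertices n j) (pt R (ord0, false)).
  by apply: hull_pt; rewrite inE.
have [k [A0 [kA0 s0E kj _]]] := simpl _ s0T; exists k => //.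
have pair k' A : (k', true) \in cone_set k' A by rewrite mem_cone_set eqxx orbT.
have pair0 k' A : k' \notin A -> (k', false) \in cone_set k' A.
  by move=> /negPf k'A; rewrite mem_cone_set k'A.
have sameT s : s \in T -> exists A, [/\ k \notin A, s = cone_set k A &
    A \subset [set l : 'I__ | (l < j)%N]].
  move=> sT; have [k' [A [k'A sE _ AJ]]] := simpl _ sT.
  have h0 : hull s0 (0 : 'rV[R]_n.+1).
    by rewrite s0E; apply: (hull0 (k := k)); rewrite ?pair ?pair0.
  have h1 : hull s (0 : 'rV[R]_n.+1).
    by rewrite sE; apply: (hull0 (k := k')); rewrite ?pair ?pair0.
  have [l [/setIP[l0 l0'] /setIP[l1 l1']]] := hull0_pair (inter _ _ _ s0T sT h0 h1).
  have [[_ i0 _] [_ i1 _]] := (simp _ s0T, simp _ sT).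
  have kl : k = l by apply: (aff_indep_pair i0); rewrite // s0E ?pair ?pair0.
  have k'l : k' = l by apply: (aff_indep_pair i1); rewrite // sE ?pair ?pair0.
  by exists A; rewrite kl -k'l.
apply/setP => s; apply/idP/imsetP => [/sameT[A [kA -> AJ]]|[A]].
  by exists A => //; rewrite inE subsetD1 AJ.
rewrite inE subsetD1 => /andP[AJ kA] ->.
(* The point [a] is the barycentre of the join: off the axis [k] its coordinates are nonzero, with
   the signs prescribed by [A]. A simplex [cone_set k B] that contains [a] must have the same signs,
   which forces [B = A]. *)
pose e : R := n.+2%:R^-1; have e0 : 0 < e by rewrite invr_gt0 ltr0n.
pose a : 'rV[R]_n.+1 := \sum_(p in cone_set k A) e *: pt R p.
have aE l : l != k -> a ord0 l = (-1) ^+ (l \in A) * e.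
  move=> lk; rewrite /a (pt_sumE (fun=> e)) !mem_cone_set (negPf lk) /= !orbF.
  by case: (l \in A); rewrite ?subr0 ?sub0r ?mul1r ?mulN1r.
have sub : cone_set k A \subset vertices n j.
  apply/subsetP => -[l b]; rewrite mem_cone_set inE /=.
  case/orP => [/eqP->|/andP[-> /eqP-> //]]; apply/implyP => lA.
  by have := subsetP AJ _ lA; rewrite inE.
have /cover[t tT [c [c0 _ act]]] : hull (vertices n j) a.
  exists (fun p => if p \in cone_set k A then e else 0); split.
  - by move=> p; case: ifP => // _; apply: ltW.
  - rewrite -big_mkcondr (eq_bigl (mem (cone_set k A))) => [|p].
      by rewrite sumr_const card_cone_set // -mulr_natr mulVf ?pnatr_eq0.
    by rewrite andb_idl //; apply: (subsetP sub).
  - rewrite /a [LHS]big_mkcond [RHS]big_mkcond; apply: eq_bigr => p _.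
    case: ifP => [/(subsetP sub)->//|_].
    by rewrite scale0r if_same.
have [B [kB tE _]] := sameT _ tT; suff -> : A = B by rewrite -tE.
apply/setP => l; have [->|lk] := eqVneq l k; first by rewrite (negPf kA) (negPf kB).
have := aE l lk; rewrite act pt_sumE tE !mem_cone_set (negPf lk) /= !orbF.
have := (c0 (l, false), c0 (l, true)).
case: (l \in A) (l \in B) => -[] //= [cf ct]; rewrite ?subr0 ?sub0r ?mul1r ?mulN1r => E.
  by move: cf; rewrite E oppr_ge0 leNgt e0.
by move: e0; rewrite -E oppr_gt0 ltNge ct.
Qed.

End Subdivision.

(** The cancellations hold only up to alternation, so the claim on supports concerns a suitable
    representative [c]. It is stated on vertices, before labelling, where entries coming from
    candidates can still be told from original ones. *)
Lemma simplicial_newP (R : realType) n j (T : {set {set vtx n}}) o :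
  subdivision R j T -> oriented_by R T o ->
  exists2 c : chain (vtx n) n.+1, alt_eq c (simplicial_new j T o) &
    forall x k, x \in dom c -> (forall i, ~~ (face k x i).2) ->
      exists2 l : 'I_n.+1, ~~ (l < j)%N &
        face k x = [ffun i => (lift l i, false)].
Proof.
pose e : sym (vtx n) n.+1 := [ffun k => (k, false)].
(* For j = 0 there are no simplices with n + 2 vertices and no side part, so the new part is [e]
   itself. *)
have [->|j0] := posnP j.
  move=> [simp _ _] _; exists (simplicial_new 0 T o); first exact: zspan_refl.
  have -> : simplicial_new 0 T o = << e >>.
    rewrite /simplicial_new /side_part big_pred0 // subr0 /old_part opprK.
    rewrite /fund_chain big_pred0 ?linear0 ?add0r // => s.
    by apply/negP => /andP[/simp[_ _ ->]]; rewrite addn0 eqn_leq ltnn andbF.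
  move=> x k; rewrite domU1 inE => /eqP -> _; exists k => //.
  by apply/ffunP => i; rewrite !ffunE.
move=> /(subdivisionP j0)[k kj TE] oT.
set J := [set l : 'I_n.+1 | (l < j)%N] in TE.
have kJ : k \in J by rewrite inE.
pose new1 : chain (vtx n) n.+1 :=
  \sum_(A in powerset J | (1 < #|A|)%N) (-1) ^+ #|A| *: << orthant A >>.
pose new2 : chain (vtx n) n.+1 := \sum_(A in powerset (J :\ k)) (-1) ^+ #|A| *:
  \sum_(l | l \notin J) (-1) ^+ l *: << prepend (k, true) (face l (orthant A)) >>.
have fundE : alt_eq (fund_chain T o)
    (\sum_(A in powerset (J :\ k))
       (-1) ^+ #|A| *: << prepend (k, true) (orthant A) >>).
  have -> : fund_chain T o = \sum_(A in powerset (J :\ k)) << o (cone_set k A) >>.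
    rewrite /fund_chain (eq_bigl (mem T)) => [|s].
      rewrite TE big_imset //= => A B; rewrite !inE !subsetD1.
      move=> /andP[_ kA] /andP[_ kB] AB; apply/setP => l.
      have [->|lk] := eqVneq l k; first by rewrite (negPf kA) (negPf kB).
      have /setP/(_ (l, true)) := AB; rewrite !mem_cone_set (negPf lk) !orbF.
      by case: (l \in A); case: (l \in B).
    rewrite andb_idr // TE => /imsetP[A]; rewrite inE subsetD1 => /andP[_ kA] ->.
    by rewrite card_cone_set.
  apply: zspan_sumB => A AJ; have [_ kA] : A \subset J /\ k \notin A.
    by apply/andP; rewrite -subsetD1 -powersetE.
  have sT : cone_set k A \in T by rewrite TE; apply: imset_f.
  have [im pos] := oT _ sT (card_cone_set kA).
  exact: alt_positive_order pos.
have sideE : alt_eq (side_part j e (fun k => (k, true)))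
    (\sum_(l in J) << orthant [set l] >>).
  rewrite /side_part [X in alt_eq _ X](eq_bigl (fun l : 'I__ => (l < j)%N)) => [|l].
    apply: zspan_sumB => l _; rewrite -[[set l]]setU0 -replace_at_orthant.
    have -> : orthant set0 = e by apply/ffunP => i; rewrite !ffunE inE.
    exact: alt_append.
  by rewrite inE.
exists (- new1 + new2).
  apply: zspan_sym; rewrite /simplicial_new -/e /old_part opprK.
  have bdryE : alt_eq (bdry (fund_chain T o)) (- (\sum_(A in powerset J)
      (-1) ^+ #|A| *: << orthant A >>) + new2).
    apply: zspan_trans (alt_eq_bdry fundE) _; rewrite linear_sum.
    under eq_bigr do rewrite linearZ.
    exact: bdry_cones.
  (* The empty set cancels the old part and the singletons cancel the side part. *)
  have -> : - new1 + new2 = (- (\sum_(A in powerset J)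
      (-1) ^+ #|A| *: << orthant A >>) + new2 + << e >>) -
      \sum_(l in J) << orthant [set l] >>.
    rewrite sum_powerset_card1 -/new1 cards0 scale1r.
    under [X in _ + X + new1]eq_bigr do rewrite cards1 scaleN1r.
    rewrite sumrN; have -> : orthant set0 = e by apply/ffunP => i; rewrite !ffunE inE.
    set S := \sum_(l in J) _; rewrite -addrA -addrA 2!opprD opprK.
    rewrite [new2 + _]addrC addrACA -addrA.
    by rewrite addrA [- _ + S + _]addrACA addNr subrr addr0 add0r.
  apply: zspan_add; last by rewrite -opprD; apply/zspanN/sideE.
  exact/(zspan_add bdryE)/zspan_refl.
have suppJ : supported (fun x => forall i, (forall i', ~~ (face i x i').2) ->
      exists2 l : 'I_n.+1, l \notin J &
        face i x = [ffun i' => (lift l i', false)]) (- new1 + new2).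
  apply: supportedD; first apply: supportedN.
    apply: supported_sum => A /andP[_ A1]; apply: supportedZ; apply: supportedU => i pos.
    (* At least two vertices are negative, so one remains after the [i]-th is dropped. *)
    have [l lA li] : exists2 l, l \in A & l != i.
      move: A1; rewrite (cardsD1 i) => A1.
      have /card_gt0P[l] : (0 < #|A :\ i|)%N.
        by rewrite lt0n; apply: contraTneq A1 => ->; case: (i \in A).
      by rewrite !inE => /andP[li lA]; exists l.
    case: (unliftP i l) li => [l' lE _|-> /eqP //].
    by have := pos l'; rewrite !ffunE -lE lA.
  apply: supported_sum => A _; apply: supportedZ.
  apply: supported_sum => l lJ; apply: supportedZ; apply: supportedU => i pos.
  (* The apex [- e_k] in position 0 is negative, so it must be the vertex dropped. *)
  exists l => //; have i0 : i = ord0.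
    case: (unliftP i ord0) => // i' iE.
    by have := pos i'; rewrite !ffunE -iE unlift_none.
  apply/ffunP => i'; have := pos i'; rewrite i0 !ffunE liftK !ffunE /=.
  by move/negPf->.
move=> x i xc /(suppJ _ xc)[l lJ xE]; exists l => //.
by move: lJ; rewrite inE.
Qed.

(** Labelling commutes with the boundary and carries the old and side parts to their labelled
    versions, so the computation on vertices transfers to sharblies. *)
Lemma eta_newE n (w : sym (pvec n) n -> pvec n) u (T : {set {set vtx n}}) o :
  push (label w u) (simplicial_new (nlarge u) T o) = eta_new w u T o.
Proof.
rewrite /simplicial_new /eta_new /eta !linearB /= push_bdry; congr (_ - _ - _).
  rewrite /old_part linearN /= pushU.
  suff -> : sym_map (label w u) [ffun k => (k, false)] = u by [].
  by apply/ffunP => i; rewrite !ffunE.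
rewrite /side_part linear_sum; apply: eq_bigr => k _; rewrite linearZ /= pushU.
suff -> : sym_map (label w u) (append (face k [ffun k => (k, false)]) (k, true)) =
  append (face k u) (w (face k u)) by [].
apply/ffunP => i; rewrite !ffunE; case: unliftP => [l|] _ //.
by rewrite !ffunE.
Qed.

Theorem theorem4p6 (R : realType) (n : nat) (Gamma : 'M[int]_n -> Prop)
    (xi : chain (pvec n) n.+1)
    (w : sym (pvec n) n -> pvec n)
    (s : sym (pvec n) n.+1 -> 'S_n.+1)
    (T : sym (pvec n) n.+1 -> {set {set vtx n}})
    (o : sym (pvec n) n.+1 -> {set vtx n} -> sym (vtx n) n.+2) :
  (2 <= n)%N ->
  (subgroup_of (@SLZ n) Gamma /\ finite_index (@SLZ n) Gamma \/
   subgroup_of (@GLZ n) Gamma /\ finite_index (@GLZ n) Gamma) ->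
  torsion_free Gamma ->
  coinv_eq Gamma (bdry xi) 0 ->
  equivariant_choice Gamma xi w ->
  (forall u, u \in dom xi -> well_ordered (reord u (s u))) ->
  (forall u, u \in dom xi -> subdivision R (nlarge (reord u (s u))) (T u)) ->
  (forall u, u \in dom xi -> oriented_by R (T u) (o u)) ->
  let ord u := reord u (s u) in
  let n' u : int := (-1) ^+ s u * coeff u xi in
  let xi' :=
    xi + bdry (\sum_(u <- dom xi) n' u *: eta w (ord u) (T u) (o u)) in
  [/\ homologous Gamma xi' xi,
      coinv_eq Gamma xi'
        (\sum_(u <- dom xi) n' u *: eta_new w (ord u) (T u) (o u)) &
      exists c : sym (pvec n) n.+1 -> chain (vtx n) n.+1,
        [/\ forall u, u \in dom xi ->
              alt_eq (c u) (simplicial_new (nlarge (ord u)) (T u) (o u)),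
            coinv_eq Gamma xi'
              (\sum_(u <- dom xi) n' u *: push (label w (ord u)) (c u)) &
            forall u x k, u \in dom xi -> x \in dom (c u) ->
              (forall i, ~~ (face k x i).2) ->
              forall g v, Gamma g -> large_sub xi v ->
                ~ translate g [ffun i => label w (ord u) (face k x i)] v]].
Proof.
move=> _ Gamma_index _ xi_cycle w_equi s_well subdT orientT ord n' xi'.
have Gamma_group : subgroup_of (@SLZ n) Gamma \/ subgroup_of (@GLZ n) Gamma.
  by case: Gamma_index => -[]; [left|right].
have xi'E : coinv_eq Gamma xi'
    (\sum_(u <- dom xi) n' u *: eta_new w (ord u) (T u) (o u)).
  pose side u := side_part (nlarge (ord u)) (ord u) (fun k => w (face k (ord u))).
  (* The old parts contribute the reordered copy of [xi] with a minus sign; what is left besides the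
     new parts is a difference killed by alternation and the side parts. *)
  have -> : xi' = xi - \sum_(u <- dom xi) n' u *: << ord u >> +
      \sum_(u <- dom xi) n' u *: side u +
      \sum_(u <- dom xi) n' u *: eta_new w (ord u) (T u) (o u).
    rewrite /xi' linear_sum -sumrN -!addrA -!big_split; congr (_ + _).
    apply: eq_bigr => u _; rewrite linearZ /= -scalerN -!scalerDr; congr (_ *: _).
    by rewrite /eta_new /old_part opprK [side u + _]addrC subrK addrC addrK.
  rewrite /coinv_eq addrK; apply: zspanD.
    exact/(alt_coinv Gamma)/reorder_chain.
  have := side_cancel Gamma_group w_equi xi_cycle s_well.
  by move=> /zspan_sym; rewrite subr0.
split=> //.
  exists (\sum_(u <- dom xi) n' u *: eta w (ord u) (T u) (o u)).
  by rewrite /xi' addrAC subrr add0r; apply: zspan_refl.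
have /boolp.choice[c cP] : forall u, exists c : chain (vtx n) n.+1, u \in dom xi ->
    alt_eq c (simplicial_new (nlarge (ord u)) (T u) (o u)) /\
    forall x k, x \in dom c -> (forall i, ~~ (face k x i).2) ->
      exists2 l : 'I_n.+1, ~~ (l < nlarge (ord u))%N &
        face k x = [ffun i => (lift l i, false)].
  move=> u; have [uxi|] := boolP (u \in dom xi); last by exists 0.
  by have [c] := simplicial_newP (subdT u uxi) (orientT u uxi); exists c.
exists c; split=> [u /cP[] //||u x k uxi xc pos g v Gg lv].
  apply: zspan_trans xi'E _; rewrite big_seq [X in _ - X]big_seq.
  apply: zspan_sumB => u /cP[cu _]; apply: zspanZB; rewrite -eta_newE.
  exact/zspan_sym/alt_coinv/alt_eq_push.
(* The labels of the face are those of the [l]-th face of the reordered [u], of norm at most 1 since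
   [l] comes after the large positions. A translate of a large submodular symbol would have norm >
   1. *)
have [l lj xE] := (cP u uxi).2 x k xc pos; rewrite xE.
have -> : [ffun i => label w (ord u) ([ffun i => (lift l i, false)] i)] =
    face l (ord u) :> sym (pvec n) n.
  by apply/ffunP => i; rewrite 2!ffunE [RHS]ffunE.
move=> /(mnorm_translate (Gamma_unit Gamma_group Gg)) norm_eq.
by move: lj; rewrite s_well // norm_eq lv.1.
Qed.
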